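(* Fix $R>0$. Let $x_1,\dots,x_n\in B(0,R)$ be any finite set. For any $A>0$ there exist continuous functions $F,G:B(0,R)\to\mathbb{R}$ such that $$F(x_i)=G(x_i)\quad (i=1,\dots,n),\qquad \sup_{\|x\|\le R}|F(x)-G(x)|\ge A.$$ Consequently, no quantity computed solely from a finite transcript $\{(x_i,F(x_i))\}_{i=1}^n$ can yield a universally valid certificate of the form $$\sup_{\|x\|\le R}|F(x)-\widetilde F(x)|\le \varepsilon$$ over such classes, unless one imposes additional structure.
   Context: $H$ is a Hilbert space with norm $\|\cdot\|$, and $B(0,R)=\{x\in H:\|x\|\le R\}$ is the ball of radius $R$ centered at $0$. In the last sentence, $F$ is a target objective accessible only through its values at finitely many query points $x_1,\dots,x_n$ (the transcript is the list of these points and values), $\widetilde F$ is a surrogate or perturbed version of $F$, and $\varepsilon$ is the error bound to be certified. ''Such classes'' refers to the functions of the first part, i.e. continuous real-valued functions on $B(0,R)$; ''additional structure'' means further assumptions such as global regularity or complexity control.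
   Formalization: The Hilbert space H is assumed to be nonzero: for H = {0} and n ≥ 1 the ball is the single point x_1 = 0, so functions that agree at x_1 are equal and the claim fails. *)

(* Defs.v *)
From HB Require Import structures.
From mathcomp Require Import all_boot all_order all_algebra.
From mathcomp Require Import all_classical all_reals all_analysis.

Set Implicit Arguments.
Unset Strict Implicit.
Unset Printing Implicit Defensive.

Import Order.TTheory GRing.Theory Num.Theory.
Import numFieldNormedType.Exports.

Local Open Scope classical_set_scope.
Local Open Scope ring_scope.

(* For a complex Hilbert space, take the underlying real space with the real
   part of the inner product: the norm is the same. *)
HB.mixin Record isHilbert (R : realType) H of CompleteNormedModule R H := {
  inner : {dot H for idfun};
  sqr_norm_inner : forall u : H, `|u| ^+ 2 = inner u u
}.

#[short(type="hilbertType")]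
HB.structure Definition Hilbert (R : realType) :=
  { H of isHilbert R H & CompleteNormedModule R H }.

Section Transcripts.
Context {R : realType} {H : hilbertType R}.

Definition cball (r : R) : set H := [set y | `|y| <= r].

(* Functions on the ball are represented by total functions whose values
   outside the ball are never used. *)
Definition continuous_on_ball (r : R) : set (H -> R) :=
  [set F | {within cball r, continuous F}].

(* Extended real: a continuous function need not be bounded on the ball when
   H is infinite-dimensional. *)
Definition sup_dist (r : R) (F G : H -> R) : \bar R :=
  ereal_sup [set `|F y - G y|%:E | y in cball r].

Definition transcript (n : nat) (x : 'I_n -> H) (F : H -> R) :
  n.-tuple (H * R) := [tuple (x i, F (x i)) | i < n].

(* S t is the set of surrogates allowed when the transcript is t. For instance
   [set Ft] is a fixed surrogate, [set s t] a surrogate computed from the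
   transcript, and S t may also consist of all continuous functions, or of
   those that interpolate t. The bound eps is an arbitrary function of the
   transcript. *)
Definition certifies (r : R) (n : nat) (x : 'I_n -> H) (C : set (H -> R))
    (S : n.-tuple (H * R) -> set (H -> R)) (eps : n.-tuple (H * R) -> R) :=
  forall F Ft : H -> R, C F -> S (transcript x F) Ft ->
    (sup_dist r F Ft <= (eps (transcript x F))%:E)%E.

(* Every target in C has an allowed surrogate, so that certifying is not
   vacuous. *)
Definition has_surrogates (n : nat) (x : 'I_n -> H) (C : set (H -> R))
    (S : n.-tuple (H * R) -> set (H -> R)) :=
  forall F : H -> R, C F -> S (transcript x F) !=set0.

End Transcripts.

(* Main.v *)
Require Import Defs.
From mathcomp Require Import all_boot all_order all_algebra.
From mathcomp Require Import all_classical all_reals all_analysis.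

Set Implicit Arguments.
Unset Strict Implicit.
Unset Printing Implicit Defensive.

Import Order.TTheory GRing.Theory Num.Theory.
Import numFieldNormedType.Exports.

Local Open Scope classical_set_scope.
Local Open Scope ring_scope.

(** A nonzero Hilbert space has infinitely many points in every ball of
    positive radius, so some point [p] of the ball is not a node. The product
    of the distances to the nodes is continuous, vanishes at every node and is
    nonzero at [p]; rescaled, it takes any prescribed value [a] at [p]
    ([node_vanishing_bump]). Adding such a function to a target changes the
    target by as much as desired without changing its transcript.

    The first claim compares such a function with [0]. For the claims about
    certificates, the key is that all targets with a given transcript are
    tested against the same surrogate with the same error bound [e], so that
    any two of them are within [2 e] of each other on the ball
    ([certified_targets_close]). If every continuous function agreed on the
    ball with some member of a certified class, then the class would have two
    members with the same transcript whose values at [p] are [0] and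
    [2 e + 1], which is absurd. So a certified class omits some continuous
    function, even up to values on the ball ([certified_class_omits]); in
    particular it cannot be the class of all continuous functions. *)

Section Nodes.
Context {R : realType} {H : hilbertType R}.

(** Among the [n + 1] distinct points [(r / (k + 1)) (v / |v|)] of the ball,
    the [n] nodes miss at least one. *)
Lemma cball_avoids_nodes (v : H) (r : R) (n : nat) (x : 'I_n -> H) :
  v != 0 -> 0 < r -> exists2 p, cball r p & forall i, p != x i.
Proof.
move=> v0 r0.
have nv0 : 0 < `|v| by rewrite normr_gt0.
pose c (k : nat) : R := r / `|v| / k.+1%:R.
have c_gt0 k : 0 < c k by rewrite !divr_gt0.
have c_inj : injective c.
  move=> k l /(mulfI (lt0r_neq0 (divr_gt0 r0 nv0))) /invr_inj /eqP.
  by rewrite eqr_nat eqSS => /eqP.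
pose q (k : 'I_n.+1) : H := c k *: v.
have q_inj : injective q.
  move=> k l /eqP; rewrite -subr_eq0 -scalerBl scaler_eq0 (negbTE v0) orbF.
  by rewrite subr_eq0 => /eqP /c_inj /val_inj.
have [all_hit|/existsNP [k miss]] :=
  pselect (forall k, exists i, q k = x i); last first.
  exists (q k); last by move=> i; apply/eqP => qx; apply: miss; exists i.
  rewrite /cball /= normrZ gtr0_norm // /c mulrAC divfK ?gt_eqF //.
  by rewrite ler_pdivrMr // ler_peMr ?(ltW r0) // ler1n.
have [f qf] := choice all_hit.
have f_inj : injective f by move=> k l fkl; apply: q_inj; rewrite !qf fkl.
by have := leq_card f f_inj; rewrite !card_ord ltnn.
Qed.

Lemma node_vanishing_bump (n : nat) (x : 'I_n -> H) (p : H) (a : R) :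
  (forall i, p != x i) ->
  exists phi : H -> R,
    [/\ continuous phi, forall i, phi (x i) = 0 & phi p = a].
Proof.
move=> px; pose d (y : H) : R := \prod_(i < n) `|y - x i|.
have d_cont : continuous d.
  apply: continuous_big => [|i _ y]; first exact: mul_continuous.
  by apply: cvg_norm; apply: cvgB; [exact: cvg_id | exact: cvg_cst].
have dp : d p != 0.
  by apply/prodf_neq0 => i _; rewrite normr_eq0 subr_eq0.
exists (fun y => a / d p * d y); split; last by rewrite divfK.
- by move=> y; apply: cvgM; [exact: cvg_cst | exact: d_cont].
- move=> i; have -> : d (x i) = 0 by rewrite /d (bigD1 i) //= subrr normr0 mul0r.
  by rewrite mulr0.
Qed.

Lemma le_sup_dist (r : R) (F G : H -> R) (y : H) :
  cball r y -> (`|F y - G y|%:E <= sup_dist r F G)%E.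
Proof. by move=> ry; apply: ereal_sup_ubound; exists y. Qed.

(** Both targets are tested against one common surrogate, so the triangle
    inequality through it applies. *)
Lemma certified_targets_close (r : R) (n : nat) (x : 'I_n -> H)
    (C : set (H -> R)) (S : n.-tuple (H * R) -> set (H -> R))
    (eps : n.-tuple (H * R) -> R) (F G : H -> R) (y : H) :
  has_surrogates x C S -> certifies r x C S eps ->
  C F -> C G -> transcript x F = transcript x G -> cball r y ->
  `|F y - G y| <= 2 * eps (transcript x F).
Proof.
move=> hasS cert CF CG FG ry; have [Ft SFt] := hasS F CF.
have near_Ft K : C K -> transcript x F = transcript x K ->
    `|K y - Ft y| <= eps (transcript x F).
  move=> CK FK; rewrite -lee_fin.
  apply: le_trans (le_sup_dist K Ft ry) _.
  by rewrite FK; apply: cert => //; rewrite -FK.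
apply: le_trans (ler_distD (Ft y) _ _) _.
rewrite mulr_natl mulr2n lerD ?near_Ft //.
by rewrite distrC near_Ft.
Qed.

Lemma eq_transcript (n : nat) (x : 'I_n -> H) (F G : H -> R) :
  (forall i, F (x i) = G (x i)) -> transcript x F = transcript x G.
Proof. by move=> FG; apply: eq_mktuple => i; rewrite FG. Qed.

Lemma continuous_continuous_on_ball (r : R) (F : H -> R) :
  continuous F -> continuous_on_ball r F.
Proof. exact: continuous_subspaceT. Qed.

(** If no continuous function were omitted, [C] would have members that share a transcript and
    are arbitrarily far apart at a point off the nodes, against
    [certified_targets_close]. *)
Lemma certified_class_omits (v : H) (r : R) (n : nat) (x : 'I_n -> H)
    (C : set (H -> R)) (S : n.-tuple (H * R) -> set (H -> R))
    (eps : n.-tuple (H * R) -> R) :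
  v != 0 -> 0 < r -> (forall i, cball r (x i)) ->
  has_surrogates x C S -> certifies r x C S eps ->
  exists F : H -> R, continuous_on_ball r F /\
    (forall G : H -> R, C G -> exists2 y, cball r y & F y <> G y).
Proof.
move=> v0 r0 rx hasS cert; apply: contrapT => no_omission.
have [p rp px] := cball_avoids_nodes x v0 r0.
have represent F : continuous_on_ball r F ->
    exists2 G, C G & forall y, cball r y -> F y = G y.
  move=> contF; apply: contrapT => noG; apply: no_omission.
  exists F; split=> // G CG; apply: contrapT => noy; apply: noG.
  exists G => // y ry; apply: contrapT => FGy; apply: noy.
  by exists y.
have [G0 CG0 G0E] :=
  represent _ (continuous_continuous_on_ball (@cst_continuous H R 0)).
have [phi [phi_cont phix phip]] :=
  node_vanishing_bump (2 * eps (transcript x G0) + 1) px.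
have [G CG GE] := represent _ (continuous_continuous_on_ball phi_cont).
have G0G : transcript x G0 = transcript x G.
  by apply: eq_transcript => i; rewrite -G0E // -GE // phix.
have := certified_targets_close hasS cert CG0 CG G0G rp.
rewrite -G0E // -GE // phip sub0r normrN leNgt => /negP; apply.
by apply: lt_le_trans (ler_norm _); rewrite ltrDl.
Qed.

End Nodes.

Theorem proposition1 (R : realType) (H : hilbertType R)
    (H_nontrivial : exists v : H, v != 0)
    (r : R) (r_gt0 : 0 < r)
    (n : nat) (x : 'I_n -> H) (x_in_ball : forall i, cball r (x i)) :
  (forall A : R, 0 < A ->
     exists F G : H -> R,
       [/\ continuous_on_ball r F, continuous_on_ball r G,
           forall i, F (x i) = G (x i)
         & (A%:E <= sup_dist r F G)%E]) /\
  (forall (S : n.-tuple (H * R) -> set (H -> R)) (eps : n.-tuple (H * R) -> R),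
     has_surrogates x (continuous_on_ball r) S ->
     ~ certifies r x (continuous_on_ball r) S eps) /\
  (* "unless one imposes additional structure" *)
  (forall (C : set (H -> R)) (S : n.-tuple (H * R) -> set (H -> R))
          (eps : n.-tuple (H * R) -> R),
     C `<=` continuous_on_ball r ->
     has_surrogates x C S ->
     certifies r x C S eps ->
     exists F : H -> R, continuous_on_ball r F /\
       (forall G : H -> R, C G -> exists2 y, cball r y & F y <> G y)).
Proof.
have [v v0] := H_nontrivial.
have [p rp px] := cball_avoids_nodes x v0 r_gt0.
split; last split.
- move=> A A_gt0; have [phi [phi_cont phix phip]] := node_vanishing_bump A px.
  exists phi, (fun=> 0); split=> //.
  + exact: continuous_continuous_on_ball.
  + by apply: continuous_continuous_on_ball; exact: cst_continuous.
  + apply: le_trans (le_sup_dist phi (fun=> 0) rp).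
    by rewrite lee_fin subr0 phip ler_norm.
- move=> S eps hasS cert.
  have [F [contF /(_ F contF) [y _]]] :=
    certified_class_omits v0 r_gt0 x_in_ball hasS cert.
  exact.
- by move=> C S eps _; exact: certified_class_omits v0 r_gt0 x_in_ball.
Qed.
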